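(* Let $n\ge 3$, let $a,b,c\in\mathbb{C}$ with $|b|\neq|c|$, and let $A=T_n(a,b,c)$ be the $n\times n$ tridiagonal Toeplitz matrix with every diagonal entry equal to $a$, every entry on the first superdiagonal equal to $b$, and every entry on the first subdiagonal equal to $c$. Let $A'$ be the matrix obtained from $A$ by swapping the $(j,j+1)$ entry with the $(j+1,j)$ entry for every odd $j$ with $1\le j\le n-1$. Then $A$ is unitarily irreducible, $A'$ is unitarily reducible, $F_A=F_{A'}$, $W(A)=W(A')$, $k(A)=\lceil n/2\rceil$, and $k(A')=2$. In particular, if $n\ge 5$, then $k(A)\neq k(A')$.
   Context: For $A\in M_n(\mathbb{C})$, the numerical range is $W(A)=\{\langle A\mathbf{x},\mathbf{x}\rangle : \mathbf{x}\in\mathbb{C}^n,\ \|\mathbf{x}\|=1\}\subset\mathbb{C}$. The Gau--Wu number $k(A)$ is the maximum size of an orthonormal set $\{\mathbf{x}_1,\dots,\mathbf{x}_k\}\subset\mathbb{C}^n$ such that every $\langle A\mathbf{x}_j,\mathbf{x}_j\rangle$ lies on the boundary $\partial W(A)$. The base polynomial of $A$ is $F_A(x:y:t)=\det(xH_1+yH_2+tI_n)$, where $H_1=(A+A^* )/2$ and $H_2=(A-A^* )/(2i)$. A matrix is unitarily reducible if it is unitarily similar to a block diagonal matrix with at least two diagonal blocks, and unitarily irreducible otherwise. *)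

(* Defs.v *)
From HB Require Import structures.
From mathcomp Require Import all_boot all_order all_algebra.
From mathcomp Require Import complex.
From mathcomp Require Import all_classical all_reals topology normedtype.
(* Only canonical structures: mpoly's notations clash with those of analysis. *)
From mathcomp Require Import (canonicals) mpoly.

Set Implicit Arguments.
Unset Strict Implicit.
Unset Printing Implicit Defensive.

Import Order.TTheory GRing.Theory Num.Theory.
Import numFieldNormedType.Exports.

Local Open Scope classical_set_scope.
Local Open Scope ring_scope.
Local Open Scope sesquilinear_scope.

(* The intended instances of C are the complex numbers R[i] over a realType R,
   whose canonical topology is the usual one of the complex plane. *)

(* Matrices act on column vectors; the inner product is linear in u. *)
Definition cdot (C : numClosedFieldType) (n : nat) (u v : 'cV[C]_n) : C :=
  dotmx u^T v^T.

Definition numerical_range (C : numClosedFieldType) (n : nat) (A : 'M[C]_n) :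
    set C :=
  [set cdot (A *m x) x | x in [set x : 'cV[C]_n | cdot x x = 1]].

Definition boundary (T : topologicalType) (S : set T) : set T :=
  closure S `\` interior S.

Definition orthonormal_family (C : numClosedFieldType) (n k : nat)
    (x : 'I_k -> 'cV[C]_n) : Prop :=
  forall i j, cdot (x i) (x j) = (i == j)%:R.

Definition has_boundary_orthonormal (C : numClosedFieldType) (n : nat)
    (A : 'M[C]_n) (k : nat) : Prop :=
  exists x : 'I_k -> 'cV[C]_n, orthonormal_family x /\
    forall j, boundary (numerical_range A) (cdot (A *m x j) (x j)).

(* The bound k < n.+1 loses nothing: see gau_wu_max. *)
Definition gau_wu (C : numClosedFieldType) (n : nat) (A : 'M[C]_n) : nat :=
  (\max_(k < n.+1 | `[< has_boundary_orthonormal A k >]) k)%N.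

Lemma orthonormal_family_leq (C : numClosedFieldType) (n k : nat)
    (x : 'I_k -> 'cV[C]_n) : orthonormal_family x -> (k <= n)%N.
Proof.
move=> xP; pose M := \matrix_(i < k) (x i)^T.
have M_unitary : M \is unitarymx.
  by apply/row_unitarymxP => i j; rewrite !rowK; exact: xP.
by rewrite -(mxrank_unitary M_unitary) rank_leq_col.
Qed.

Lemma gau_wu_max (C : numClosedFieldType) (n : nat) (A : 'M[C]_n) :
  has_boundary_orthonormal A (gau_wu A) /\
  forall k, has_boundary_orthonormal A k -> (k <= gau_wu A)%N.
Proof.
split=> [|k kP]; last first.
  have kn : (k < n.+1)%N by case: (kP) => x [/orthonormal_family_leq].
  by apply: (bigop.leq_bigmax_cond (Ordinal kn)); apply/asboolP.
rewrite /gau_wu; elim/big_ind: _ => [|k l kP lP|k /asboolP//].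
  by exists (fun=> 0); split=> [[]|[]].
by rewrite /maxn; case: ifP.
Qed.

Definition herm_re (C : numClosedFieldType) (n : nat) (A : 'M[C]_n) :
    'M[C]_n := 2^-1 *: (A + A ^t*).

Definition herm_im (C : numClosedFieldType) (n : nat) (A : 'M[C]_n) :
    'M[C]_n := (2 * 'i)^-1 *: (A - A ^t*).

(* The variables x, y, t of F_A(x : y : t) have indices 0, 1, 2. *)
Definition base_poly (C : numClosedFieldType) (n : nat) (A : 'M[C]_n) :
    mpoly.mpoly 3 C :=
  let toP : 'M[C]_n -> 'M_n := map_mx (@mpoly.mpolyC 3 C) in
  let X (k : nat) : mpoly.mpoly 3 C := mpoly.mpolyX C (mpoly.mnm1 (inord k)) in
  \det (X 0%N *: toP (herm_re A) + X 1%N *: toP (herm_im A)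
        + (X 2%N)%:M).

Definition unitarily_reducible (C : numClosedFieldType) (n : nat)
    (A : 'M[C]_n) : Prop :=
  exists (m : nat) (p : 'I_m -> nat) (e : (\sum_i p i)%N = n)
         (B : forall i, 'M[C]_(p i)) (U : 'M[C]_n),
    [/\ (2 <= m)%N, forall i, (0 < p i)%N, U \is unitarymx
      & A = U *m castmx (e, e) (\mxdiag_(i < m) B i) *m U ^t*].

Definition toeplitz3 (C : numClosedFieldType) (n : nat) (a b c : C) :
    'M[C]_n :=
  \matrix_(i, j) if i == j then a
                 else if i.+1 == j then b
                 else if j.+1 == i then c
                 else 0.

(* Indices start at 0 here, so the 1-based odd j are the even ones. *)
Definition swap_odd (C : Type) (n : nat) (A : 'M[C]_n) : 'M[C]_n :=
  \matrix_(i, j) if ((i.+1 == j) && ~~ odd i) || ((j.+1 == i) && ~~ odd j)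
                 then A j i else A i j.

(* Main.v *)
(* Put s(x) = <Sx, x> for the shift S. Since <Ax, x> = a + b s + c s^* on unit
   vectors and |b| <> |c|, the map s |-> a + b s + c s^* is a real-affine
   bijection of the plane, so everything is read off from s. Swapping b and c on
   an edge of the path replaces one term x_(j+1) x_j^* of s by its conjugate,
   which does not change the values that s takes: in both cases they fill the
   disc of radius rho = cos (pi / (n + 1)). The bound |s| <= rho comes from the
   positive eigenvector w_j = sin (j pi / (n + 1)) of S + S^* : for |om| = 1 the
   number 2 rho |x|^2 - 2 Re (om s) is a sum of squares, which vanishes exactly
   when x is a multiple of a wave x_j = (unimodular phase) * w_j. The boundary
   of W is thus attained at the waves of parameter z, |z| = 1: the phases are
   z^j for A, and 1, z^*, 1, z^*, ... for A'.
   Two waves of A' with parameters z, z' are orthogonal iff z' = - z, whence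
   k(A') = 2. For A, with N = n + 1 and q = exp (2 i pi / N), they are
   orthogonal iff u = z / z' satisfies u^N = 1, u <> 1, q, q^-1, or u = -1, so
   that the numbers z_i and q z_i are pairwise distinct, and k(A) = floor (N/2).
   A' is reducible because the even and odd parts of w span a subspace that
   reduces it; a matrix commuting with A and A^* commutes with S and S^*, hence
   is scalar. Finally F_A is a tridiagonal determinant, which depends on the
   off-diagonal entries only through the products of opposite ones. *)

Require Import Defs.
From mathcomp Require Import all_boot all_order all_algebra.
From mathcomp Require Import complex.
From mathcomp Require Import all_classical all_reals topology normedtype trigo.
From mathcomp Require Import ring zify.
From mathcomp Require Import (canonicals) mpoly.

Import Order.TTheory GRing.Theory Num.Theory.
Import numFieldNormedType.Exports.

Local Open Scope ring_scope.
Local Open Scope sesquilinear_scope.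
Set Implicit Arguments.
Unset Strict Implicit.
Unset Printing Implicit Defensive.

(** * Tridiagonal determinants and the base polynomial *)

Definition tridiag (T : nmodType) (n : nat) (d u l : nat -> T) : 'M[T]_n :=
  \matrix_(i, j) if i == j then d i
                 else if i.+1 == j then u i
                 else if j.+1 == i then l j
                 else 0.

Lemma det_tridiag_rec (S : comNzRingType) (n : nat) (d u l : nat -> S) :
  \det (tridiag n.+2 d u l) =
    d 0 * \det (tridiag n.+1 (d \o succn) (u \o succn) (l \o succn))
    - u 0 * l 0 * \det (tridiag n (d \o succn \o succn) (u \o succn \o succn)
                                  (l \o succn \o succn)).
Proof.
rewrite (expand_det_row _ ord0) !big_ord_recl big1 ?addr0; last first.
  by move=> i _; rewrite !mxE /= mul0r.
rewrite /cofactor !mxE /= !addn0 expr0 mul1r expr1 mulN1r mulrN; congr (_ * \det _ - _).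
  apply/matrixP=> i j; rewrite !mxE -!val_eqE /= /bump /= !add1n !eqSS.
  by [].
rewrite -mulrA; congr (_ * _).
rewrite (expand_det_col _ ord0) !big_ord_recl big1 ?addr0; last first.
  by move=> i _; rewrite !mxE /= mul0r.
rewrite /cofactor !mxE /= !addn0 expr0 mul1r; congr (_ * \det _).
by apply/matrixP=> i j; rewrite !mxE -!val_eqE /= /bump /= !add1n !eqSS.
Qed.

(** The recurrence sees the off-diagonal entries only through the products [u i * l i]. It goes back
    two sizes, hence the strong induction. *)
Lemma det_tridiag_eq (S : comNzRingType) (n : nat) (d u l u' l' : nat -> S) :
  (forall i, u i * l i = u' i * l' i) ->
  \det (tridiag n d u l) = \det (tridiag n d u' l').
Proof.
have [k nk] := ubnP n; elim: k => // k IHk in n nk d u l u' l' *.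
case: n nk => [|[|n]] nk ulE; first by rewrite !det_mx00.
  by rewrite !det_mx11 !mxE.
by rewrite !det_tridiag_rec ulE; congr (_ * _ - _ * _);
  apply: IHk => [|i]; rewrite /= ?ulE //; lia.
Qed.

Lemma det_swap_odd (S : comNzRingType) (n : nat) (M : 'M[S]_n) :
  (forall i j : 'I_n, i != j -> i.+1 != j -> j.+1 != i -> M i j = 0) ->
  \det (swap_odd M) = \det M.
Proof.
case: n M => [|n] M M0; first by rewrite !det_mx00.
(* Beyond the last index [inord] falls back to 0, but no entry of [tridiag] reads these values. *)
pose d i := M (inord i) (inord i); pose u i := M (inord i) (inord i.+1).
pose l i := M (inord i.+1) (inord i).
have -> : swap_odd M = tridiag n.+1 d (fun i => if odd i then u i else l i)
                                      (fun i => if odd i then l i else u i).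
  apply/matrixP=> i j; rewrite !mxE /d /u /l.
  case: (eqVneq i j) => [<-|ij].
    by rewrite inord_val; case: ifP.
  case: (eqVneq i.+1 j) => [ij1|ij1].
    rewrite ij1 !inord_val (negbTE (_ : j.+1 != i)) /=; last by lia.
    by rewrite orbF; case: (odd i).
  case: (eqVneq j.+1 i) => [ji1|ji1]; last by rewrite /= M0.
  by rewrite ji1 !inord_val /=; case: (odd j).
have -> : M = tridiag n.+1 d u l.
  apply/matrixP=> i j; rewrite !mxE /d /u /l.
  case: (eqVneq i j) => [<-|ij]; first by rewrite inord_val.
  case: (eqVneq i.+1 j) => [ij1|ij1]; first by rewrite ij1 !inord_val.
  case: (eqVneq j.+1 i) => [ji1|ji1]; last by rewrite M0.
  by rewrite ji1 !inord_val.
by apply: det_tridiag_eq => i; case: (odd i) => //; rewrite mulrC.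
Qed.

Lemma base_poly_swap_odd (C : numClosedFieldType) (n : nat) (a b c : C) :
  base_poly (swap_odd (toeplitz3 n a b c)) = base_poly (toeplitz3 n a b c).
Proof.
rewrite /base_poly; cbv zeta.
rewrite -[RHS](@det_swap_odd (mpoly.mpoly 3 C)) => [|i j ij ij1 ji1]; last first.
  rewrite !mxE [j == i]eq_sym (negbTE ij) (negbTE ij1) (negbTE ji1).
  by rewrite !(conjC0, addr0, subr0, mulr0, mpoly.mpolyC0).
apply: (congr1 (@determinant (mpoly.mpoly 3 C) n)); apply/matrixP=> i j.
rewrite !mxE [j == i]eq_sym.
rewrite [(j.+1 == i) && _ || _]orbC.
case: (eqVneq i j) => [<-|ij]; last by case: ifP.
by rewrite !(gtn_eqF (ltnSn i)).
Qed.

(** * The boundary of an ellipse *)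

Section Boundary.
Variable C : numClosedFieldType.
Variables (a b c rho : C).
Hypotheses (bc : `|b| != `|c|) (rho_gt0 : 0 < rho).

Let ellipse := [set a + b * s + c * s^* | s in [set s | `|s| <= rho]]%classic.

Let det := b * b^* - c * c^*.

Let det_neq0 : det != 0.
Proof. by rewrite /det -!normCK subr_eq0 eqrXn2. Qed.

Let det_conj : det^* = det.
Proof. by rewrite /det rmorphB !rmorphM /= !conjCK; ring. Qed.

(* The inverse of s |-> a + b s + c s^*. *)
Definition coord (z : C) : C := (b^* * (z - a) - c * (z - a)^*) / det.

Lemma coordK s : coord (a + b * s + c * s^*) = s.
Proof.
rewrite /coord; have -> : a + b * s + c * s^* - a = b * s + c * s^* by ring.
rewrite rmorphD !rmorphM /= conjCK; apply: (mulIf det_neq0).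
by rewrite mulfVK // /det; ring.
Qed.

Lemma coordKV z : a + b * coord z + c * (coord z)^* = z.
Proof.
rewrite /coord; set u := z - a; have -> : z = a + u by rewrite /u; ring.
have -> : ((b^* * u - c * u^*) / det)^* = (b * u^* - c^* * u) / det.
  by rewrite rmorphM fmorphV /= det_conj rmorphB !rmorphM /= !conjCK.
move: det_neq0; rewrite /det => det0; by field.
Qed.

Lemma ellipseP z : ellipse z <-> `|coord z| <= rho.
Proof.
split=> [[s /= s_rho <-]|z_rho]; first by rewrite coordK.
by exists (coord z) => //; rewrite coordKV.
Qed.

(** Inside, [coord] is Lipschitz, so a small ball around the point stays in the ellipse. On the rim,
    points pushed away from the centre [a] leave the ellipse at once. *)
Lemma boundary_ellipse s : `|s| <= rho ->
  boundary ellipse (a + b * s + c * s^*) <-> `|s| = rho.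
Proof.
move=> s_rho; set p := a + _ + _.
have pE : ellipse p by apply/ellipseP; rewrite coordK.
split=> [[_ pI]|sE].
  apply/eqP; rewrite eq_le s_rho /= real_leNgt ?normr_real ?gtr0_real //.
  apply/negP => s_lt; apply: pI.
  (* A Lipschitz constant of [coord], increased by 1 to be positive. *)
  pose K := (`|b| + `|c|) / `|det| + 1.
  have K_gt0 : 0 < K by rewrite ltr_wpDl // divr_ge0 // addr_ge0.
  apply/nbhs_ballP; exists ((rho - `|s|) / K) => /=.
    by rewrite divr_gt0 // subr_gt0.
  move=> z; rewrite -ball_normE /= ltr_pdivlMr // => pz; apply/ellipseP.
  have -> : coord z = s + (coord z - s) by ring.
  rewrite (le_trans (ler_normD _ _)) // -lerBrDl.
  apply: le_trans (ltW pz).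
  have -> : coord z - s = (b^* * (z - p) - c * (z - p)^*) / det.
    rewrite -{1}(coordK s) -/p /coord -mulrBl; congr (_ / _).
    by rewrite !rmorphB; ring.
  rewrite normrM normfV ler_pdivrMr ?normr_gt0 // [`|p - z|]distrC.
  rewrite (le_trans (ler_normB _ _)) // !normrM !norm_conjC -mulrDl.
  have -> : `|z - p| * K * `|det| = (`|b| + `|c|) * `|z - p| + `|z - p| * `|det|.
    by rewrite /K; field; rewrite normr_eq0.
  by rewrite lerDl mulr_ge0.
split; first exact: subset_closure.
move=> /nbhs_ballP [e /= e_gt0 pe].
(* Moving from [p] by [d * (p - a)] covers less than [e] and multiplies the coordinate by [1 + d].
   The 1 in [M] avoids a division by zero. *)
pose M := `|p - a| + 1; have M_gt0 : 0 < M by rewrite ltr_wpDl.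
pose d := e / 2 / M; have d_gt0 : 0 < d by rewrite !divr_gt0.
pose z := p + d * (p - a).
have /pe /ellipseP : ball p e z.
  rewrite -ball_normE /= /z opprD addNKr normrN normrM gtr0_norm // /d.
  rewrite (@le_lt_trans _ _ (e / 2)) //; last by rewrite gtr_pMr // invf_lt1 ?ltr1n.
  by rewrite mulrAC ler_pdivrMr // ler_pM2l ?divr_gt0 // lerDl.
have -> : coord z = (1 + d) * s.
  rewrite -[RHS]coordK /z /p rmorphM rmorphD /= conjC1.
  by rewrite [d^*]geC0_conj ?ltW //; congr coord; ring.
rewrite normrM gtr0_norm ?addr_gt0 // sE mulrDl mul1r gerDl.
by rewrite lt_geF // mulr_gt0.
Qed.

End Boundary.

(** * Unitary reducibility *)

Lemma adjmxM (C : numClosedFieldType) (m n p : nat) (A : 'M[C]_(m, n))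
  (B : 'M[C]_(n, p)) : (A *m B)^t* = B^t* *m A^t*.
Proof. by rewrite trmx_mul map_mxM. Qed.

(** Irreducibility only needs a two-part splitting of the indices: [f] separates the first block
    from all the others. *)
Lemma unitarily_reducible_split (C : numClosedFieldType) (n : nat)
    (A : 'M[C]_n) : unitarily_reducible A ->
  exists (U D : 'M[C]_n) (f : pred 'I_n),
    [/\ U \is unitarymx, A = U *m D *m U^t*, exists x, f x, exists x, ~~ f x
      & forall x y, f x != f y -> D x y = 0].
Proof.
case=> m [p [e [B [U [m2 p_gt0 UU AE]]]]].
case: n / e in A U UU AE *; rewrite castmx_id in AE.
pose i0 : 'I_m := Ordinal (ltnW m2); pose i1 : 'I_m := Ordinal m2.
exists U, (mxdiag B), (fun s => tagnat.sig1 s == i0); split=> //.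
- by exists (tagnat.Rank i0 (Ordinal (p_gt0 i0))); rewrite tagnat.Rank1K.
- by exists (tagnat.Rank i1 (Ordinal (p_gt0 i1))); rewrite tagnat.Rank1K.
move=> x y fxy; rewrite mxE ifN ?mxE //.
by apply: contra fxy => /eqP ->.
Qed.

Definition shift_mx (C : numClosedFieldType) (n : nat) : 'M[C]_n :=
  \matrix_(i, j) (i.+1 == j)%:R.

(** Multiplying by the shift on the right moves columns to the right, on the left it moves rows up.
    Comparing entries makes [P] constant along diagonals, and column 0 of [P *m shift_mx C n.+1] is
    zero. *)
Lemma comm_shift_mx (C : numClosedFieldType) (n : nat) (P : 'M[C]_n.+1) :
  P *m shift_mx C n.+1 = shift_mx C n.+1 *m P ->
  (forall i j, (i < n)%N -> (j < n)%N ->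
     P (inord i) (inord j) = P (inord i.+1) (inord j.+1)) /\
  (forall i, (i < n)%N -> P (inord i.+1) ord0 = 0).
Proof.
move=> PS.
have PSE i j : (j < n)%N -> (P *m shift_mx C n.+1) i (inord j.+1) = P i (inord j).
  move=> jn; rewrite mxE (bigD1 (inord j)) //= big1 ?addr0 => [|k].
    by rewrite mxE !inordK ?eqxx ?mulr1 //; lia.
  rewrite -val_eqE mxE /= !inordK; try lia.
  by move=> kj; rewrite eqSS (negbTE kj) mulr0.
have SPE i j : (i < n)%N -> (shift_mx C n.+1 *m P) (inord i) j = P (inord i.+1) j.
  move=> jn; rewrite mxE (bigD1 (inord i.+1)) //= big1 ?addr0 => [|k].
    by rewrite mxE !inordK ?eqxx ?mul1r //; lia.
  rewrite -val_eqE mxE /= !inordK; try lia.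
  by move=> kj; rewrite eq_sym (negbTE kj) mul0r.
split=> [i j i_n j_n|i i_n]; first by rewrite -PSE // PS SPE.
rewrite -SPE // -PS mxE big1 // => k _.
by rewrite mxE mulr0.
Qed.

Lemma comm_shift_scalar (C : numClosedFieldType) (n : nat) (P : 'M[C]_n) :
  P *m shift_mx C n = shift_mx C n *m P ->
  P *m (shift_mx C n)^T = (shift_mx C n)^T *m P -> is_scalar_mx P.
Proof.
case: n P => [|n] P PS; first by rewrite [P]flatmx0 mx0_is_scalar.
move=> /(congr1 trmx); rewrite !trmx_mul !trmxK => PTS.
have [Pdiag Plow] := comm_shift_mx PS.
have [_ Pup] := comm_shift_mx (esym PTS).
have PE i j : (i <= n)%N -> (j <= n)%N ->
    P (inord i) (inord j) = (i == j)%:R * P ord0 ord0.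
  have o0 : inord 0 = ord0 :> 'I_n.+1 by apply/val_inj; rewrite /= inordK.
  elim: i j => [|i IHi] [|j] im jm; rewrite ?o0 ?mul1r ?mul0r //.
  - by have := Pup j jm; rewrite mxE.
  - exact: Plow.
  by rewrite -Pdiag // IHi ?eqSS //; exact: ltnW.
apply/is_scalar_mxP; exists (P ord0 ord0); apply/matrixP=> i j.
by rewrite -{1}(inord_val i) -{1}(inord_val j) PE ?leq_ord // !mxE mulr_natl.
Qed.

Lemma toeplitz3_shift (C : numClosedFieldType) (n : nat) (a b c : C) :
  toeplitz3 n a b c = a%:M + b *: shift_mx C n + c *: (shift_mx C n)^T.
Proof.
apply/matrixP=> i j; rewrite !mxE.
case: (eqVneq i j) => [<-|ij].
  by rewrite (gtn_eqF (ltnSn i)) !mulr0 !addr0.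
case: (eqVneq i.+1 j) => [ij1|_]; last first.
  by rewrite add0r mulr0 add0r; case: eqP; rewrite ?mulr1 ?mulr0.
by rewrite (negbTE (_ : j.+1 != i)) ?mulr0 ?mulr1 ?addr0 ?add0r //; lia.
Qed.

(** A block decomposition yields an orthogonal projection [P] commuting with the matrix and its
    adjoint. It must be scalar, yet [E], which is unitarily similar to it, has both 1 and 0 on its
    diagonal. *)
Lemma toeplitz3_irreducible (C : numClosedFieldType) (n : nat) (a b c : C) :
  `|b| != `|c| -> ~ unitarily_reducible (toeplitz3 n a b c).
Proof.
move=> bc /unitarily_reducible_split [U [D [f [UU AE [x fx] [y fy] D0]]]].
set A := toeplitz3 _ _ _ _ in AE.
pose E : 'M[C]_n := diag_mx (\row_i (f i)%:R).
have UUi : U^t* *m U = 1%:M.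
  by have /unitarymxP := UU; apply: mulmx1C.
have EE : E^t* = E.
  rewrite tr_diag_mx map_diag_mx; congr diag_mx.
  by apply/rowP=> i; rewrite !mxE /= rmorph_nat.
have DE : D *m E = E *m D.
  rewrite mul_mx_diag mul_diag_mx; apply/matrixP=> i j; rewrite !mxE mulrC.
  by have [->|/D0 ->] := eqVneq (f i) (f j); rewrite ?mulr0.
pose P := U *m E *m U^t*.
have PA : P *m A = A *m P.
  rewrite AE /P -!mulmxA ![U^t* *m (U *m _)]mulmxA UUi !mul1mx.
  by rewrite ![E *m (D *m _)]mulmxA ![D *m (E *m _)]mulmxA DE.
have PP : P^t* = P by rewrite /P !adjmxM trmxCK EE mulmxA.
have PA' : P *m A^t* = A^t* *m P by rewrite -{1}PP -{2}PP -!adjmxM PA.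
have AT : A^t* = a^*%:M + c^* *: shift_mx C n + b^* *: (shift_mx C n)^T.
  rewrite /A toeplitz3_shift; apply/matrixP=> i j.
  rewrite !mxE [j == i]eq_sym !(rmorphD, rmorphM) /= rmorphMn !conjC_nat /=; ring.
have det0 : b * b^* - c * c^* != 0 by rewrite -!normCK subr_eq0 eqrXn2.
pose det := b * b^* - c * c^*.
have comb (s t r : C) :
    P *m (r%:M + s *: A + t *: A^t*) = (r%:M + s *: A + t *: A^t*) *m P.
  by rewrite !mulmxDr !mulmxDl -!scalemxAr -!scalemxAl PA PA' scalar_mxC.
have /is_scalar_mxP [l Pl] : is_scalar_mx P.
  apply: comm_shift_scalar.
    (* Cramer's rule for the linear system that expresses [A] and its adjoint through the identity,
       the shift and its transpose. *)
    have -> : shift_mx C n = ((c * a^* - b^* * a) / det)%:M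
               + (b^* / det) *: A + (- c / det) *: A^t*.
      rewrite AT /A toeplitz3_shift; apply/matrixP=> i j; rewrite !mxE /det.
      by case: (i == j); rewrite ?mulr1n ?mulr0n; field.
    exact: comb.
  have -> : (shift_mx C n)^T = ((c^* * a - b * a^*) / det)%:M
             + (- c^* / det) *: A + (b / det) *: A^t*.
    rewrite AT /A toeplitz3_shift; apply/matrixP=> i j; rewrite !mxE /det.
    by case: (i == j); rewrite ?mulr1n ?mulr0n; field.
  exact: comb.
have El : E = l%:M.
  have : U^t* *m P *m U = U^t* *m l%:M *m U by rewrite Pl.
  by rewrite /P !mulmxA UUi mul1mx -mulmxA UUi mulmx1 scalar_mxC -mulmxA UUi mulmx1.
have := congr1 (fun M : 'M_n => M x x) El; rewrite !mxE eqxx fx /= => l1.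
have := congr1 (fun M : 'M_n => M y y) El; rewrite !mxE eqxx (negbTE fy) /= -l1.
by move/eqP; rewrite eq_sym oner_eq0.
Qed.

Lemma unitarily_reducible_blocks (C : numClosedFieldType) (n r : nat)
    (A U D : 'M[C]_n) : (0 < r)%N -> (r < n)%N -> U \is unitarymx ->
  A = U *m D *m U^t* ->
  (forall x y : 'I_n, (x < r)%N != (y < r)%N -> D x y = 0) ->
  unitarily_reducible A.
Proof.
move=> r0 rn UU AE D0.
pose p (i : 'I_2) := if i == ord0 then r else (n - r)%N.
have e : (\sum_i p i)%N = n.
  by rewrite !big_ord_recl big_ord0 /p /= addn0 subnKC // ltnW.
pose D' := castmx (esym e, esym e) D.
have Rank_lt i (k : 'I_(p i)) : (tagnat.Rank i k < r)%N = (i == ord0).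
  rewrite tagnat.RankEsum; case: i k => [[|[|//]] ? k].
    rewrite big1 => [|j]; last by [].
    by rewrite add0n; have := ltn_ord k; rewrite {2}/p => ->.
  rewrite big_mkcond !big_ord_recl big_ord0 /= /p /= -val_eqE /=.
  by apply/negbTE; rewrite -leqNgt; lia.
exists 2, p, e, (fun i => submxblock D' i i), U; split=> // [i|].
  by rewrite /p; case: ifP => //; rewrite subn_gt0.
rewrite AE; congr (_ *m _ *m _).
suff -> : mxdiag (fun i => submxblock D' i i) = D'.
  by rewrite /D' castmx_comp castmx_id.
rewrite -[RHS]submxblockK; apply: eq_mxblock => i j.
have [<-|ij] := eqVneq i j; first by rewrite conform_mx_id.
apply/esym/matrixP=> k l; rewrite !mxE castmxE D0 //= !Rank_lt.
by case: i j ij k l => [[|[|//]] ?] [[|[|//]] ?].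
Qed.

(** Orthonormal bases of the row space of [V] and of its orthogonal complement, stacked, form a
    unitary matrix. Invariance under [A] kills one off-diagonal block, invariance under the adjoint
    kills the other. *)
Lemma unitarily_reducible_reducing (C : numClosedFieldType) (n k : nat)
    (A : 'M[C]_n) (V : 'M[C]_(k, n)) :
  (0 < \rank V)%N -> (\rank V < n)%N ->
  (V *m A <= V)%MS -> (V *m A^t* <= V)%MS -> unitarily_reducible A.
Proof.
move=> V0 Vn VA VA'.
have aux r s (e : (r + s)%N = n) (W1 : 'M[C]_(r, n)) (W2 : 'M[C]_(s, n)) :
    (0 < r)%N -> (r < n)%N -> col_mx W1 W2 \is unitarymx ->
    W1 *m A *m W2^t* = 0 -> W2 *m A *m W1^t* = 0 -> unitarily_reducible A.
  case: n / e in A {V V0 Vn VA VA'} W1 W2 * => r0 rn WU W12 W21.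
  set W := col_mx W1 W2 in WU.
  have WW : W^t* *m W = 1%:M by have /unitarymxP := WU; apply: mulmx1C.
  apply: (@unitarily_reducible_blocks _ _ r A (W^t*) (W *m A *m W^t*)) => //.
  - by rewrite trmxC_unitary.
  - by rewrite trmxCK !mulmxA WW mul1mx -mulmxA WW mulmx1.
  move=> x y.
  have -> : W *m A *m W^t* = block_mx (W1 *m A *m W1^t*) 0 0 (W2 *m A *m W2^t*).
    by rewrite /W tr_col_mx map_row_mx mul_col_mx mul_col_row W12 W21.
  case: (split_ordP x) => x' ->; case: (split_ordP y) => y' -> /=; rewrite ?ltn_ord //.
  - by move=> _; rewrite block_mxEur mxE.
  by move=> _; rewrite block_mxEdl mxE.
have W1V : (schmidt (row_base V) :=: V)%MS.
  by apply: eqmx_trans (eqmx_schmidt_free (row_base_free V)) (eq_row_base V).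
pose V' := orthomx Num.conj (mx_of_hermitian (hermitian1mx n)) V.
have W2V : (schmidt (row_base V') :=: V')%MS.
  by apply: eqmx_trans (eqmx_schmidt_free (row_base_free V')) (eq_row_base V').
have orth m1 (X : 'M[C]_(m1, n)) : (X <= V)%MS -> X *m (schmidt (row_base V'))^t* = 0.
  move=> XV; apply/orthomx1P.
  by rewrite (submx_trans XV) // orthomx_sym W2V.
apply: (aux _ _ (add_rank_ortho V) (schmidt (row_base V)) (schmidt (row_base V'))) => //.
- exact: schmidt_complete_unitarymx.
- by apply: orth; apply: submx_trans VA; rewrite submxMr // W1V.
apply: (can_inj (@trmxCK _ _ _)).
rewrite !adjmxM trmxCK trmx0 map_mx0 mulmxA.
by congr (_^T); apply: orth; apply: submx_trans VA'; rewrite submxMr // W1V.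
Qed.

(** * The hopping form along a path *)

Lemma gau_wuE (C : numClosedFieldType) (n : nat) (A : 'M[C]_n) (k : nat) :
  has_boundary_orthonormal A k ->
  (forall l, has_boundary_orthonormal A l -> (l <= k)%N) -> gau_wu A = k.
Proof.
move=> Ak Ale; have [Amax Ageq] := gau_wu_max A.
by apply/eqP; rewrite eqn_leq Ale //= Ageq.
Qed.

Lemma sum_window (V : nmodType) (F : nat -> V) (j N : nat) : (j.+2 < N)%N ->
  (forall k, k != j -> k != j.+1 -> k != j.+2 -> F k = 0) ->
  \sum_(0 <= k < N) F k = F j + F j.+1 + F j.+2.
Proof.
move=> jN F0; rewrite (@big_cat_nat _ _ _ j) /=; [|lia|lia].
rewrite (@big_cat_nat _ _ _ j.+3 j) /=; [|lia|lia].
rewrite big_nat big1 => [|k kj]; last by apply: F0; lia.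
rewrite [X in _ + (_ + X)]big_nat [X in _ + (_ + X)]big1 => [|k kj]; last first.
  by apply: F0; lia.
by rewrite 3?big_nat_recr ?big_geq //= ?addr0 ?add0r //; lia.
Qed.

Lemma cdot_col (C : numClosedFieldType) (n : nat) (x y : 'I_n -> C) :
  cdot (\col_i x i) (\col_i y i) = \sum_i x i * (y i)^*.
Proof.
by rewrite /cdot dotmxE !mxE; apply: eq_bigr => i _; rewrite !mxE.
Qed.

Lemma cdot_tridiag (C : numClosedFieldType) (m : nat) (d u l X : nat -> C) :
  cdot (tridiag m.+1 d u l *m \col_i X i) (\col_i X i) =
    \sum_(i < m.+1) d i * (X i * (X i)^*) +
    \sum_(i < m) (u i * (X i.+1 * (X i)^*) + l i * (X i * (X i.+1)^*)).
Proof.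
pose f i j : C := if i == j then d i else if i.+1 == j then u i
                else if j.+1 == i then l j else 0.
have -> : tridiag m.+1 d u l *m \col_i X i =
          \col_i (\sum_(j < m.+1) f i j * X j).
  by apply/colP=> i; rewrite !mxE; apply: eq_bigr => j _; rewrite !mxE.
rewrite cdot_col; elim: m => [|m IHm].
  by rewrite !big_ord_recl !big_ord0 /f /= !addr0 mulrA.
rewrite big_ord_recr [in RHS]big_ord_recr [X in _ = _ + X]big_ord_recr /=.
have -> : \sum_(i < m.+1) (\sum_(j < m.+2) f i j * X j) * (X i)^* =
  \sum_(i < m.+1) (\sum_(j < m.+1) f i j * X j) * (X i)^*
    + u m * (X m.+1 * (X m)^*).
  under eq_bigr do rewrite big_ord_recr /= mulrDl.
  rewrite big_split /=; congr (_ + _).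
  rewrite big_ord_recr /= big1 ?add0r => [|i _].
    by rewrite /f eqxx (ltn_eqF (ltnSn _)) mulrA.
  have im := ltn_ord i.
  by rewrite /f !ifN ?mul0r //; apply/eqP; lia.
have -> : \sum_(j < m.+2) f m.+1 j * X j = l m * X m + d m.+1 * X m.+1.
  rewrite big_ord_recr big_ord_recr /= big1 ?add0r => [|i _].
    by rewrite /f !eqxx !(gtn_eqF (ltnSn _)) (gtn_eqF (ltnW (ltnSn _))).
  have im := ltn_ord i.
  by rewrite /f !ifN ?mul0r //; apply/eqP; lia.
rewrite IHm; ring.
Qed.

(* [up] records the orientation of each edge of the path: [xpredT] for A, [odd]
   (with indices starting at 0) for A'. *)
Definition toeplitz_up (C : numClosedFieldType) (n : nat) (up : pred nat)
    (a b c : C) : 'M[C]_n :=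
  tridiag n (fun=> a) (fun i => if up i then b else c)
                      (fun i => if up i then c else b).

Lemma toeplitz3_up (C : numClosedFieldType) (n : nat) (a b c : C) :
  toeplitz3 n a b c = toeplitz_up n xpredT a b c.
Proof. by []. Qed.

Lemma swap_odd_up (C : numClosedFieldType) (n : nat) (a b c : C) :
  swap_odd (toeplitz3 n a b c) = toeplitz_up n odd a b c.
Proof.
apply/matrixP=> i j; rewrite !mxE [j == i]eq_sym.
case: (eqVneq i j) => [<-|ij]; first by case: ifP.
case: (eqVneq i.+1 j) => [ij1|ij1].
  rewrite (negbTE (_ : j.+1 != i)) /=; last by lia.
  by rewrite orbF; case: (odd i).
by case: (eqVneq j.+1 i) => [ji1|ji1] //=; case: (odd j).
Qed.

Section Hopping.
Variable C : numClosedFieldType.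
Implicit Types (up : pred nat) (X : nat -> C) (m : nat) (z s om : C).

Definition hopping up m X : C :=
  \sum_(i < m) (if up i then X i.+1 * (X i)^* else X i * (X i.+1)^*).

Definition sqnorm m X : C := \sum_(i < m.+1) X i * (X i)^*.

Lemma cdot_toeplitz_up up m a b c X :
  cdot (toeplitz_up m.+1 up a b c *m \col_i X i) (\col_i X i) =
    a * sqnorm m X + b * hopping up m X + c * (hopping up m X)^*.
Proof.
rewrite cdot_tridiag /sqnorm /hopping mulr_sumr -addrA; congr (_ + _).
rewrite rmorph_sum !mulr_sumr -big_split /=; apply: eq_bigr => i _.
by case: (up i); rewrite rmorphM /= conjCK; ring.
Qed.

Lemma cV_nat_col m (x : 'cV[C]_m.+1) :
  exists X, x = \col_i X i.
Proof.
by exists (fun i => x (inord i) 0); apply/colP=> i; rewrite mxE inord_val.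
Qed.

(** The phase increment along an edge, chosen so that every edge contributes the same factor [z] to
    [hopping], whatever its orientation. *)
Definition twist up z i : C := if up i then z else z^*.

Fixpoint phase up z i : C :=
  if i is j.+1 then phase up z j * twist up z j else 1.

(* Vectors have the entries X 0, ..., X m, but the weights are shifted: X i is
   paired with w i.+1, so that w vanishes just outside the path. *)
Variables (m : nat) (w : nat -> C) (rho : C).
Hypotheses (w0 : w 0 = 0) (wN : w m.+2 = 0).
Hypothesis w_gt0 : forall i, (i <= m)%N -> 0 < w i.+1.
Hypothesis wS : forall i, w i + w i.+2 = 2 * rho * w i.+1.
Hypothesis m_gt0 : (0 < m)%N.

Let w_conj i : (i <= m)%N -> (w i.+1)^* = w i.+1.
Proof. by move=> im; rewrite geC0_conj // ltW // w_gt0. Qed.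

Let rho_gt0 : 0 < rho.
Proof.
have := wS 0; rewrite w0 add0r => w2.
have : 0 < 2 * rho * w 1 by rewrite -w2 w_gt0.
by rewrite pmulr_lgt0 ?w_gt0 // pmulr_rgt0 // ltr0n.
Qed.

(* The boundary term at [X k] disappears for [k = m] because [w m.+2 = 0]. *)
Lemma sum_of_squares (om : nat -> C) X k : (k <= m)%N ->
  (forall i, om i * (om i)^* = 1) ->
  \sum_(i < k) w i.+1 * w i.+2 *
      `|X i / w i.+1 - om i * X i.+1 / w i.+2| ^+ 2 =
  2 * rho * sqnorm k X - w k.+2 / w k.+1 * (X k * (X k)^*)
  - \sum_(i < k) (om i * (X i.+1 * (X i)^*) + (om i)^* * (X i * (X i.+1)^*)).
Proof.
(* The two squares that meet at [X k] give it the coefficient [(w k + w k.+2) / w k.+1 = 2 * rho].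
   At the end of a partial sum the second of them is missing, which is the correction term. *)
move=> km om1; elim: k km => [|k IHk] km.
  rewrite /sqnorm big_ord_recl !big_ord0 !addr0 subr0.
  have := wS 0; rewrite w0 add0r => ->.
  by rewrite mulfK ?subrr // gt_eqF // w_gt0.
rewrite big_ord_recr [in RHS]big_ord_recr /= IHk; last by lia.
have -> : sqnorm k.+1 X = sqnorm k X + X k.+1 * (X k.+1)^*.
  by rewrite /sqnorm big_ord_recr.
rewrite normCK rmorphB !rmorphM /= !fmorphV /= !w_conj; try by lia.
have p0 : w k.+1 != 0 by rewrite gt_eqF // w_gt0 //; lia.
have r0 : w k.+2 != 0 by rewrite gt_eqF // w_gt0 //; lia.
have -> : w k.+3 = 2 * rho * w k.+2 - w k.+1 by rewrite -wS; ring.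
have := om1 k; set o := om k; set o' := (om k)^*; move=> oo.
have o0 : o != 0 by apply/eqP=> o0; move: oo => /eqP; rewrite o0 mul0r eq_sym oner_eq0.
have -> : o' = o^-1 by apply: (mulfI o0); rewrite oo mulfV.
by field; rewrite o0 r0 p0.
Qed.

Lemma twist_unit up z i : `|z| = 1 -> twist up z i * (twist up z i)^* = 1.
Proof.
move=> z1; have zz : z * z^* = 1 by rewrite -normCK z1 expr1n.
by rewrite /twist; case: (up i); rewrite // conjCK mulrC.
Qed.

Lemma sum_of_squares_hopping up om X : `|om| = 1 ->
  \sum_(i < m) w i.+1 * w i.+2 *
      `|X i / w i.+1 - twist up om i * X i.+1 / w i.+2| ^+ 2 =
  2 * rho * sqnorm m X - (om * hopping up m X + (om * hopping up m X)^*).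
Proof.
move=> om1; rewrite sum_of_squares // => [|i]; last exact: twist_unit.
rewrite wN !mul0r subr0; congr (_ - _).
rewrite /hopping mulr_sumr rmorph_sum -big_split; apply: eq_bigr => i _ /=.
by rewrite /twist; case: (up i); rewrite !rmorphM /= ?conjCK; ring.
Qed.

Lemma unit_rotation z : exists2 om : C, `|om| = 1 & om * z = `|z|.
Proof.
have [->|z0] := eqVneq z 0; first by exists 1; rewrite ?normr1 // mulr0 normr0.
have nz0 : `|z| != 0 by rewrite normr_eq0.
exists (z^* / `|z|); first by rewrite normf_div normr_id norm_conjC divff.
by apply: (mulIf nz0); rewrite mulrAC mulfVK // -expr2 normCKC.
Qed.

Lemma sum_of_squares_ge0 up om X i : (i < m)%N ->
  0 <= w i.+1 * w i.+2 *
         `|X i / w i.+1 - twist up om i * X i.+1 / w i.+2| ^+ 2.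
Proof.
by move=> im; rewrite !mulr_ge0 ?exprn_ge0 // ltW // w_gt0 //; lia.
Qed.

Lemma hopping_le up X : `|hopping up m X| <= rho * sqnorm m X.
Proof.
have [om om1 omh] := unit_rotation (hopping up m X).
have := sum_of_squares_hopping up X om1.
rewrite omh geC0_conj // => E.
have : 0 <= 2 * rho * sqnorm m X - (`|hopping up m X| + `|hopping up m X|).
  by rewrite -E sumr_ge0 // => i _; apply: sum_of_squares_ge0.
by rewrite subr_ge0 -mulr2n -[_ *+ 2]mulr_natl -[2 * rho * _]mulrA ler_pM2l ?ltr0n.
Qed.

Lemma phase_unit up z i : `|z| = 1 -> phase up z i * (phase up z i)^* = 1.
Proof.
move=> z1; elim: i => [|i IHi] /=; first by rewrite conjC1 mulr1.
by rewrite rmorphM mulrACA IHi twist_unit ?mulr1.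
Qed.

(** Equality makes every square vanish, so that each entry determines the next one; the parameter of
    the resulting wave is the conjugate of the rotation [om]. *)
Lemma hopping_eq up X : `|hopping up m X| = rho * sqnorm m X ->
  exists2 z, `|z| = 1 &
  exists k, forall i, (i <= m)%N -> X i = k * (phase up z i * w i.+1).
Proof.
move=> hE; have [om om1 omh] := unit_rotation (hopping up m X).
have := sum_of_squares_hopping up X om1.
rewrite omh geC0_conj // hE.
have -> : 2 * rho * sqnorm m X - (rho * sqnorm m X + rho * sqnorm m X) = 0 by ring.
move=> /eqP.
rewrite psumr_eq0 => [/allP E|i _]; last exact: sum_of_squares_ge0.
exists om^*; first by rewrite norm_conjC.
exists (X 0 / w 1); elim=> [|i IHi] im.
  by rewrite mul1r mulfVK // gt_eqF // w_gt0.
have p0 : w i.+1 != 0 by rewrite gt_eqF // w_gt0 //; lia.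
have r0 : w i.+2 != 0 by rewrite gt_eqF // w_gt0 //; lia.
have := E (Ordinal im) (mem_index_enum _); rewrite /= !mulf_eq0 orbb.
rewrite (negbTE p0) (negbTE r0) /= normr_eq0 subr_eq0 IHi; last by lia.
rewrite !mulrA mulfK // => /eqP; move: (X 0 / w 1 * _) => e ->.
have -> : twist up om^* i = (twist up om i)^* by rewrite /twist; case: (up i).
by rewrite -[LHS]mul1r -(twist_unit up i om1); field.
Qed.

Let D : C := \sum_(i < m.+1) w i.+1 ^+ 2.

Let D_gt0 : 0 < D.
Proof.
rewrite /D big_ord_recl ltr_wpDr ?exprn_gt0 ?w_gt0 // sumr_ge0 // => i _.
by rewrite exprn_ge0 // ltW // w_gt0 //; apply: ltn_ord.
Qed.

(** The eigenvector equation paired with [w]. Partial sums leave the boundary product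
    [w k.+1 * w k.+2], which vanishes at [k = m]. *)
Lemma sum_w_succ : \sum_(i < m) w i.+1 * w i.+2 = rho * D.
Proof.
have E k : 2 * (\sum_(i < k) w i.+1 * w i.+2) + w k.+1 * w k.+2 =
           2 * rho * \sum_(i < k.+1) w i.+1 ^+ 2.
  elim: k => [|k IHk].
    rewrite big_ord_recl !big_ord0 mulr0 add0r addr0.
    by have := wS 0; rewrite w0 add0r => ->; ring.
  rewrite big_ord_recr [in RHS]big_ord_recr /= [RHS]mulrDr -IHk.
  by rewrite expr2 [2 * rho * (_ * _)]mulrA -wS; ring.
have := E m; rewrite wN mulr0 addr0 -mulrA.
by apply: mulfI; rewrite pnatr_eq0.
Qed.

(** The alternating sum telescopes up to the factor [2 * rho], which is nonzero. Hence the even and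
    odd parts of [w] have equal norms. *)
Lemma sum_w_alt : \sum_(i < m.+1) (-1) ^+ i * w i.+1 ^+ 2 = 0.
Proof.
have E k : 2 * rho * (\sum_(i < k.+1) (-1) ^+ i * w i.+1 ^+ 2) =
           (-1) ^+ k * (w k.+1 * w k.+2).
  elim: k => [|k IHk].
    rewrite big_ord_recl !big_ord0 addr0.
    by have := wS 0; rewrite w0 add0r => ->; ring.
  rewrite big_ord_recr /= mulrDr IHk.
  have -> : w k.+3 = 2 * rho * w k.+2 - w k.+1 by rewrite -wS; ring.
  by rewrite exprS; ring.
have /eqP := E m; rewrite wN !mulr0 mulf_eq0 => /orP[|/eqP//].
by rewrite mulf_eq0 pnatr_eq0 /= gt_eqF.
Qed.

Lemma sum_w_parity (u v : C) :
  \sum_(i < m.+1) (if odd i then v else u) * w i.+1 ^+ 2 = (u + v) / 2 * D.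
Proof.
transitivity (\sum_(i < m.+1) ((u + v) / 2 * w i.+1 ^+ 2 +
               (u - v) / 2 * ((-1) ^+ i * w i.+1 ^+ 2))).
  by apply: eq_bigr => i _; rewrite -signr_odd; case: (odd i); rewrite ?expr1; field.
by rewrite big_split /= -!mulr_sumr sum_w_alt mulr0 addr0.
Qed.

(* The even and odd parts of w have equal norms, so scaling them independently
   moves [hopping] along a whole radius of the disc. *)
Definition parity_wave up z al be i : C :=
  (if odd i then be else al) * (phase up z i * w i.+1).

Lemma sqnorm_parity_wave up z al be : `|z| = 1 -> al^* = al -> be^* = be ->
  sqnorm m (parity_wave up z al be) = (al ^+ 2 + be ^+ 2) / 2 * D.
Proof.
move=> z1 alR beR; rewrite -sum_w_parity; apply: eq_bigr => i _.
have := phase_unit up i z1; rewrite /parity_wave; set p := phase _ _ _ => pp.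
have im := ltn_ord i.
rewrite !rmorphM /= w_conj //.
by case: (odd i); rewrite ?alR ?beR mulrACA; congr (_ * _);
  rewrite mulrACA pp mul1r.
Qed.

(** Each edge joins an even vertex to an odd one, hence the common factor [al * be]; the phases
    contribute [z]. *)
Lemma hopping_parity_wave up z al be : `|z| = 1 -> al^* = al -> be^* = be ->
  hopping up m (parity_wave up z al be) = al * be * z * (rho * D).
Proof.
move=> z1 alR beR; rewrite -sum_w_succ mulr_sumr; apply: eq_bigr => i _.
have im := ltn_ord i.
have := phase_unit up i z1; rewrite /parity_wave /=; set p := phase _ _ _ => pp.
transitivity (al * be * z * (w i.+1 * w i.+2) * (p * p^*)); last by rewrite pp mulr1.
rewrite /twist; case: (up i); case: (odd i) => /=;
 rewrite !rmorphM /= ?conjCK ?alR ?beR !w_conj //; try lia; ring.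
Qed.

(** * The numerical range and its orthonormal boundary vectors *)

Lemma numerical_range_toeplitz_up up a b c :
  numerical_range (toeplitz_up m.+1 up a b c) =
  [set a + b * s + c * s^* | s in [set s | `|s| <= rho]]%classic.
Proof.
apply/seteqP; split=> [y [x /= x1 <-]|y [s /= s_rho <-]].
  have [X xX] := cV_nat_col x; rewrite xX cdot_toeplitz_up.
  have X1 : sqnorm m X = 1 by rewrite -x1 xX cdot_col.
  exists (hopping up m X) => /=; last by rewrite X1 mulr1.
  by rewrite -[rho]mulr1 -X1 hopping_le.
have [om om1 oms] := unit_rotation s.
have sE : s = `|s| * om^*.
  by rewrite -oms mulrAC -normCK om1 expr1n mul1r.
pose t := `|s| / rho.
have t0 : 0 <= t by rewrite divr_ge0 // ltW.
have t1 : t <= 1 by rewrite ler_pdivrMr // mul1r.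
(* The solution of [al ^+ 2 + be ^+ 2 = 2 / D] and [al * be = t / D], which make the norm 1 and the
   hopping value [s]. The square roots are real because [0 <= t <= 1]. *)
pose al := (sqrtC (1 + t) + sqrtC (1 - t)) / sqrtC (2 * D).
pose be := (sqrtC (1 + t) - sqrtC (1 - t)) / sqrtC (2 * D).
have sp : (sqrtC (1 + t))^* = sqrtC (1 + t).
  by rewrite geC0_conj // sqrtC_ge0 addr_ge0.
have sm : (sqrtC (1 - t))^* = sqrtC (1 - t).
  by rewrite geC0_conj // sqrtC_ge0 subr_ge0.
have sD : (sqrtC (2 * D))^* = sqrtC (2 * D).
  by rewrite geC0_conj // sqrtC_ge0 mulr_ge0 // ltW.
have alR : al^* = al by rewrite /al rmorphM rmorphD fmorphV /= sp sm sD.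
have beR : be^* = be by rewrite /be rmorphM rmorphB fmorphV /= sp sm sD.
have D0 : D != 0 by rewrite gt_eqF.
have rho0 : rho != 0 by rewrite gt_eqF.
have om1' : `|om^*| = 1 by rewrite norm_conjC.
pose X := parity_wave up om^* al be.
have X1 : sqnorm m X = 1.
  rewrite sqnorm_parity_wave // /al /be !exprMn !exprVn sqrtCK -mulrDl.
  rewrite sqrrD sqrrB !sqrtCK; field.
  by rewrite D0.
have Xs : hopping up m X = s.
  rewrite hopping_parity_wave //.
  have -> : al * be = t / D.
    transitivity ((sqrtC (1 + t) ^+ 2 - sqrtC (1 - t) ^+ 2) / sqrtC (2 * D) ^+ 2).
      by rewrite /al /be subr_sqr; field; rewrite sqrtC_eq0 mulf_neq0 // pnatr_eq0.
    by rewrite !sqrtCK; field.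
  rewrite [RHS]sE /t; field; exact/andP.
exists (\col_i X i); first by rewrite /= cdot_col.
by rewrite cdot_toeplitz_up X1 Xs mulr1.
Qed.

Definition wave_dot up z z' : C :=
  \sum_(i < m.+1) phase up z i * (phase up z' i)^* * w i.+1 ^+ 2.

(** Boundary vectors are multiples of waves by the equality case, and normalised waves reach the
    boundary. Only the orthogonality of the parameters remains to be studied. *)
Lemma has_boundary_orthonormalP up (a b c : C) k : `|b| != `|c| ->
  has_boundary_orthonormal (toeplitz_up m.+1 up a b c) k <->
  exists2 z : 'I_k -> C, forall i, `|z i| = 1 &
    forall i j, i != j -> wave_dot up (z i) (z j) = 0.
Proof.
move=> bc.
have bdE X : sqnorm m X = 1 ->
    boundary (numerical_range (toeplitz_up m.+1 up a b c))
      (cdot (toeplitz_up m.+1 up a b c *m \col_i X i) (\col_i X i)) <->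
    `|hopping up m X| = rho * sqnorm m X.
  move=> X1; rewrite numerical_range_toeplitz_up cdot_toeplitz_up X1 !mulr1.
  by apply: boundary_ellipse => //; rewrite -[rho]mulr1 -X1 hopping_le.
have dotE (p q z z' : C) : \sum_(i < m.+1)
    p * (phase up z i * w i.+1) * (q * (phase up z' i * w i.+1))^* =
    p * q^* * wave_dot up z z'.
  rewrite mulr_sumr; apply: eq_bigr => i _; have im := ltn_ord i.
  by rewrite !rmorphM /= w_conj //; ring.
split=> [[x [x_on x_bd]]|[z z1 zz]].
  have /fin_all_exists2 [z z1 zP] i : exists2 z, `|z| = 1 & exists k,
      x i = \col_j (k * (phase up z j * w j.+1)).
    have [X xX] := cV_nat_col (x i).
    have X1 : sqnorm m X = 1 by have := x_on i i; rewrite eqxx xX cdot_col.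
    have := x_bd i; rewrite xX => /(bdE _ X1) /hopping_eq [z z1 [l Xl]].
    by exists z => //; exists l; apply/colP=> j; rewrite !mxE Xl // -ltnS.
  have {zP} /fin_all_exists [l xE] := zP.
  exists z => // i j ij; have := x_on i j.
  rewrite (negbTE ij) [x i]xE [x j]xE cdot_col dotE => /eqP.
  rewrite mulf_eq0 => /orP [lij|/eqP //].
  have l_neq0 h : l h != 0.
    apply/eqP => lh; have := x_on h h.
    by rewrite eqxx [x h]xE cdot_col dotE lh !mul0r => /eqP; rewrite eq_sym oner_eq0.
  by move: lij; rewrite mulf_eq0 conjC_eq0 !(negbTE (l_neq0 _)).
pose l := (sqrtC D)^-1.
have lR : l^* = l by rewrite geC0_conj // invr_ge0 sqrtC_ge0 ltW.
have l2 : l * l * D = 1.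
  by rewrite -expr2 exprVn sqrtCK mulVf // gt_eqF.
have zz1 i : wave_dot up (z i) (z i) = D.
  by apply: eq_bigr => j _; rewrite phase_unit // mul1r.
pose X i j := l * (phase up (z i) j * w j.+1).
have X1 i : sqnorm m (X i) = 1 by rewrite /sqnorm dotE zz1 lR l2.
exists (fun i => \col_j X i j); split=> [i j|i].
  rewrite cdot_col dotE; case: eqVneq => [->|ij]; first by rewrite zz1 lR l2.
  by rewrite zz // mulr0.
apply/bdE => //; rewrite X1 mulr1.
(* A wave is a parity wave with equal amplitudes, so its hopping value is [z i * rho]. *)
have -> : X i = parity_wave up (z i) l l.
  by apply/funext => j; rewrite /X /parity_wave if_same.
rewrite hopping_parity_wave // -[RHS]mulr1 -l2.
have -> : l * l * z i * (rho * D) = z i * (rho * (l * l * D)) by ring.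
by rewrite normrM z1 mul1r l2 mulr1 gtr0_norm.
Qed.

(** * Reducing subspace of the swapped matrix *)

Definition parity_row al be : 'rV[C]_m.+1 :=
  \row_j ((if odd j then be else al) * w j.+1).

(** After the swap both off-diagonal entries of column [j] are equal: [c] for odd [j], [b] for even
    [j]. They multiply [w j + w j.+2], which is [2 * rho * w j.+1]. *)
Lemma parity_row_mul al be (a b c : C) :
  parity_row al be *m toeplitz_up m.+1 odd a b c =
    parity_row (a * al + 2 * rho * b * be) (a * be + 2 * rho * c * al).
Proof.
apply/rowP=> j; rewrite !mxE; have jm := ltn_ord j.
(* The row index is shifted by one and the sum padded at both ends, where [w] vanishes, so that
   every column, even the first and the last, has three terms. *)
pose F i := (if odd i then al else be) * w i *
  (if i == j.+1 then a else if i == j then (if odd j then c else b)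
   else if i == j.+2 then (if odd j then c else b) else 0).
transitivity (\sum_(0 <= i < m.+3) F i).
  rewrite big_nat_recl // big_nat_recr //= {1 3}/F w0 wN !mulr0 !mul0r add0r addr0.
  rewrite big_mkord; apply: eq_bigr => i _; rewrite !mxE /F /= if_neg.
  congr (_ * _); rewrite !eqSS -val_eqE /=; case: eqVneq => // ij.
  rewrite [i == j.+1 :> nat]eq_sym; case: (eqVneq i.+1 (j : nat)) => // <- /=.
  by case: (odd i).
rewrite (@sum_window _ F j) => [|//|k kj kj1 kj2]; last first.
  by rewrite /F (negbTE kj) (negbTE kj1) (negbTE kj2) mulr0.
rewrite /F eqxx (ltn_eqF (ltnSn j)) eqxx (gtn_eqF (ltnSn _)).
rewrite (gtn_eqF (ltnW (ltnSn _))) eqxx /= negbK.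
have -> : w j.+2 = 2 * rho * w j.+1 - w j by rewrite -wS; ring.
by case: (odd j) => /=; ring.
Qed.

(** The adjoint has the same form with other coefficients, so it preserves the same span, whose
    dimension is at most 2 and thus less than [m.+1]. *)
Lemma toeplitz_up_odd_reducible (a b c : C) : (1 < m)%N ->
  unitarily_reducible (toeplitz_up m.+1 odd a b c).
Proof.
move=> m1; pose V := col_mx (parity_row 1 0) (parity_row 0 1).
have VP al be : (parity_row al be <= V)%MS.
  have -> : parity_row al be = row_mx al%:M be%:M *m V.
    rewrite mul_row_col !mul_scalar_mx; apply/rowP=> j; rewrite !mxE.
    by case: (odd j); ring.
  exact: submxMl.
have VT a' b' c' : (V *m toeplitz_up m.+1 odd a' b' c' <= V)%MS.
  by rewrite mul_col_mx !parity_row_mul col_mx_sub !VP.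
apply: (@unitarily_reducible_reducing _ _ _ _ V) => //.
- rewrite lt0n mxrank_eq0; apply/eqP => V0.
  have := congr1 (fun M => usubmx M 0 0) V0.
  by rewrite col_mxKu !mxE mul1r => /eqP; rewrite gt_eqF // w_gt0.
- by apply: leq_ltn_trans (rank_leq_row _) _.
have -> : (toeplitz_up m.+1 odd a b c)^t* = toeplitz_up m.+1 odd a^* c^* b^*.
  apply/matrixP=> i j; rewrite !mxE [j == i]eq_sym.
  case: (eqVneq i j) => [_|ij] //.
  case: (eqVneq i.+1 j) => [ij1|_]; last first.
    by case: (eqVneq j.+1 i) => _; [case: (odd j)|rewrite conjC0].
  by rewrite (negbTE (_ : j.+1 != i)); [case: (odd i)|lia].
exact: VT.
Qed.

(** * Orthogonality of boundary vectors *)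

Lemma conj_unit z : `|z| = 1 -> z^* = z^-1.
Proof. by move=> z1; rewrite invC_norm z1 expr1n invr1 mul1r. Qed.

Lemma unit_neq0 z : `|z| = 1 -> z != 0.
Proof. by move=> z1; rewrite -normr_eq0 z1 oner_neq0. Qed.

Lemma phase_odd z i : `|z| = 1 -> phase odd z i = if odd i then z^* else 1.
Proof.
move=> z1; elim: i => //= i ->; rewrite /twist; case: (odd i); last exact: mul1r.
by rewrite mulrC -normCK z1 expr1n.
Qed.

(** The phases depend only on the parity of the index, so the inner product is [D] times the mean of
    1 and [z' / z]. *)
Lemma wave_dot_odd_eq0 z z' : `|z| = 1 -> `|z'| = 1 ->
  wave_dot odd z z' = 0 <-> z' = - z.
Proof.
move=> z1 z1'; have -> : wave_dot odd z z' = (1 + z' / z) / 2 * D.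
  rewrite -sum_w_parity; apply: eq_bigr => i _; rewrite !phase_odd //.
  case: (odd i); last by rewrite conjC1 mulr1.
  by rewrite conjCK conj_unit // [z' * _]mulrC.
have D0 : D != 0 by rewrite gt_eqF.
have z0 := unit_neq0 z1.
split=> [/eqP|->]; last by rewrite mulNr divff // subrr !mul0r.
rewrite !mulf_eq0 invr_eq0 pnatr_eq0 /= (negbTE D0) !orbF addrC addr_eq0 => /eqP E.
by rewrite -[z'](divfK z0) E mulN1r.
Qed.

Lemma gau_wu_odd (a b c : C) : `|b| != `|c| ->
  gau_wu (toeplitz_up m.+1 odd a b c) = 2%N.
Proof.
move=> bc; apply: gau_wuE => [|k] /=.
  apply/has_boundary_orthonormalP => //; exists (fun i : 'I_2 => (-1) ^+ i).
    by move=> i; rewrite normrX normrN1 expr1n.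
  move=> i j ij; apply/wave_dot_odd_eq0; rewrite ?normrX ?normrN1 ?expr1n //.
  by case: i j ij => [[|[|//]] ?] [[|[|//]] ?] //= _; rewrite ?expr0 ?expr1 ?opprK.
move=> /has_boundary_orthonormalP [] // z z1 zz.
case: k => [|[|[|k]]] // in z z1 zz *.
have opp i j : i != j -> z j = - z i.
  by move=> ij; apply/wave_dot_odd_eq0 => //; exact: zz.
pose i0 : 'I_k.+3 := inord 0; pose i1 : 'I_k.+3 := inord 1.
pose i2 : 'I_k.+3 := inord 2.
have ne x y : (x < 3)%N -> (y < 3)%N -> x != y ->
    (inord x : 'I_k.+3) != inord y.
  by move=> x3 y3 xy; rewrite -val_eqE /= !inordK //; lia.
(* Three pairwise opposite parameters would satisfy [z i0 = - z i0]. *)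
have := opp i0 i1; rewrite (opp i2 i1) ?ne // (opp i0 i2) ?ne //.
move=> /(_ isT) /eqP; rewrite eqr_opp eqNr => /eqP z0.
by have := z1 i0; rewrite z0 normr0 => /eqP; rewrite eq_sym oner_eq0.
Qed.

(** * Roots of unity and the Gau-Wu number of the Toeplitz matrix *)

Variables q kappa : C.
Hypotheses (q0 : q != 0) (kappa0 : kappa != 0) (m_gt1 : (1 < m)%N).
Hypothesis wq : forall i, w i ^+ 2 = kappa * (2 - q ^+ i - q ^- i).

(** Up to a nonzero factor, [w i ^+ 2] is the square of [q ^+ i - 1]. The zeros of [w] thus make [q]
    a primitive root of unity of order [m.+2]. *)
Lemma expr_q_eq1 i : (q ^+ i == 1) = (w i == 0).
Proof.
have qi : q ^+ i != 0 by rewrite expf_neq0.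
have E : w i ^+ 2 = - kappa / q ^+ i * (q ^+ i - 1) ^+ 2 by rewrite wq; field.
rewrite -[RHS]sqrf_eq0 E !mulf_eq0 oppr_eq0 invr_eq0 (negbTE kappa0).
by rewrite (negbTE qi) /= orbb subr_eq0.
Qed.

Lemma expr_q_neq1 i : (0 < i)%N -> (i < m.+2)%N -> q ^+ i != 1.
Proof. by case: i => // i _ im; rewrite expr_q_eq1 gt_eqF // w_gt0. Qed.

Lemma expr_q_inj i j : (i < m.+2)%N -> (j < m.+2)%N -> q ^+ i = q ^+ j -> i = j.
Proof.
have H k l : (l < m.+2)%N -> (k <= l)%N -> q ^+ k = q ^+ l -> k = l.
  move=> lm kl /eqP; rewrite -(subnKC kl) exprD -{1}[q ^+ k]mulr1.
  rewrite eq_sym (inj_eq (mulfI (expf_neq0 _ q0))).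
  have [-> _|lk] := posnP (l - k); first by rewrite addn0.
  by rewrite (negbTE (expr_q_neq1 _ _)) //; lia.
move=> im jm; case: (leqP i j) => [ij|/ltnW ij]; first exact: H.
by move/esym/H => ->.
Qed.

Let qN : q ^+ m.+2 = 1.
Proof. by apply/eqP; rewrite expr_q_eq1 wN. Qed.

Let q1 : q != 1.
Proof. by have := @expr_q_neq1 1; rewrite expr1; apply. Qed.

Let geom (x : C) := \sum_(i < m.+2) x ^+ i.

Let geom1 : geom 1 = m.+2%:R.
Proof.
by rewrite /geom (eq_bigr (fun=> 1)) => [|i _]; rewrite ?expr1n // sumr_const card_ord.
Qed.

Let geomE x : x != 1 -> geom x = (x ^+ m.+2 - 1) / (x - 1).
Proof.
rewrite -subr_eq0 => x1; apply: (mulIf x1).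
by rewrite divfK // (subrX1 _ m.+2) mulrC.
Qed.

Let geom0 x : x ^+ m.+2 = 1 -> x != 1 -> geom x = 0.
Proof. by move=> xN x1; rewrite geomE // xN subrr mul0r. Qed.

Lemma phase_predT z i : phase xpredT z i = z ^+ i.
Proof. by elim: i => //= i ->; rewrite exprSr. Qed.

(** The factor [z / z'] aligns exponents with the shifted weights, and the term of index 0 is free
    since [w 0 = 0]. Expanding the squared weights then leaves three geometric sums. *)
Lemma wave_dot_predT z z' : `|z| = 1 -> `|z'| = 1 ->
  z / z' * wave_dot xpredT z z' =
    kappa * (2 * geom (z / z') - geom (z / z' * q) - geom (z / z' / q)).
Proof.
move=> z1 z1'; set u := z / z'.
transitivity (\sum_(i < m.+2) u ^+ i * w i ^+ 2).
  rewrite big_ord_recl w0 expr0n mulr0 add0r mulr_sumr; apply: eq_bigr => i _.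
  rewrite !phase_predT rmorphXn /= conj_unit // -exprMn -/u /bump /= add1n.
  by rewrite mulrA -exprS.
clearbody u.
rewrite /geom mulr_sumr -!sumrB mulr_sumr; apply: eq_bigr => i _.
by rewrite wq !exprMn exprVn; ring.
Qed.

Lemma wave_dot_predT_eq0 z z' : `|z| = 1 -> `|z'| = 1 ->
  (z / z') ^+ m.+2 = 1 -> z != z' -> z * q != z' -> z != z' * q ->
  wave_dot xpredT z z' = 0.
Proof.
move=> z1 z1' zzN zz zqz zzq; have z0 := unit_neq0 z1; have z0' := unit_neq0 z1'.
have u1 : z / z' != 1 by apply: contra zz => /eqP/divr1_eq ->.
have uq : z / z' * q != 1.
  by rewrite mulrAC; apply: contra zqz => /eqP/divr1_eq ->.
have uq' : z / z' / q != 1.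
  by rewrite -mulrA -invfM; apply: contra zzq => /eqP/divr1_eq {1}->; rewrite mulrC.
have /eqP := wave_dot_predT z1 z1'.
have uqN : (z / z' * q) ^+ m.+2 = 1 by rewrite exprMn zzN qN mulr1.
have uqN' : (z / z' / q) ^+ m.+2 = 1 by rewrite exprMn exprVn zzN qN invr1 mulr1.
rewrite !geom0 //.
by rewrite mulr0 !subr0 mulr0 !mulf_eq0 invr_eq0 (negbTE z0) (negbTE z0') => /eqP.
Qed.

(** If the ratio [u] is 1, [q] or the inverse of [q], exactly one geometric sum is [m.+2] and the
    other two vanish, so the total is nonzero. Otherwise the closed forms apply. *)
Lemma wave_dot_predT_neq0 z z' : `|z| = 1 -> `|z'| = 1 ->
  wave_dot xpredT z z' = 0 ->
  [/\ z != z', z * q != z' & (z / z') ^+ m.+2 = 1 \/ z = - z'].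
Proof.
move=> z1 z1' zz0; have z0 := unit_neq0 z1; have z0' := unit_neq0 z1'.
have q10 : 1 - q != 0 by rewrite subr_eq0 eq_sym.
have qV1 : q^-1 != 1 by rewrite invr_eq1.
have qVN : q^-1 ^+ m.+2 = 1 by rewrite exprVn qN invr1.
have N0 : m.+2%:R != 0 :> C by rewrite pnatr_eq0.
have := wave_dot_predT z1 z1'; rewrite zz0 mulr0 => /esym/eqP.
rewrite mulf_eq0 (negbTE kappa0) /= => /eqP.
set u := z / z' => G0.
have u0 : u != 0 by rewrite mulf_neq0 // invr_eq0.
have zu : z = u * z' by rewrite divfK.
clearbody u; rewrite {}zu.
have u1 : u != 1.
  apply/eqP => uE; move: G0; rewrite uE !mul1r geom1 !geom0 // !subr0 => /eqP.
  by rewrite mulf_eq0 pnatr_eq0 (negbTE N0).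
have uq : u * q != 1.
  apply/eqP => uqE; have uE : u = q^-1 by apply: (mulIf q0); rewrite uqE mulVf.
  move: G0; rewrite uqE uE geom1 !geom0 //.
  - by rewrite mulr0 sub0r subr0 => /eqP; rewrite oppr_eq0 (negbTE N0).
  - by rewrite -expr2 exprAC qVN expr1n.
  - by rewrite -expr2 exprVn invr_eq1 expr_q_neq1.
have uq' : u / q != 1.
  apply/eqP => uqE; have uE : u = q by apply: (mulIf (invr_neq0 q0)); rewrite uqE mulfV.
  move: G0; rewrite uqE uE geom1 !geom0 //.
  - by rewrite mulr0 subr0 sub0r => /eqP; rewrite oppr_eq0 (negbTE N0).
  - by rewrite -expr2 exprAC qN expr1n.
  - by rewrite -expr2 expr_q_neq1.
split.
- by apply: contra u1 => /eqP zE; apply/eqP/(mulIf z0'); rewrite mul1r.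
- by apply: contra uq => /eqP zE; apply/eqP/(mulIf z0'); rewrite mul1r mulrAC.
have uN : u ^+ m.+2 = 1 \/ u = -1.
  move: G0; rewrite !geomE // !exprMn exprVn qN invr1 !mulr1.
  have [->|uN1] := eqVneq (u ^+ m.+2) 1; first by left.
  rewrite -subr_eq0 in uN1; rewrite -subr_eq0 in u1; rewrite -subr_eq0 in uq.
  have uq2 : u - q != 0.
    by apply: contra uq' => /eqP/subr0_eq ->; rewrite divff.
  rewrite -subr_eq0 in uq'; move/eqP => E; right; move: E.
  (* Over a common denominator, [u + 1] is the only factor left that can vanish. *)
  have -> : 2 * ((u ^+ m.+2 - 1) / (u - 1)) - (u ^+ m.+2 - 1) / (u * q - 1)
      - (u ^+ m.+2 - 1) / (u / q - 1) =
    - ((u ^+ m.+2 - 1) * (1 - q) ^+ 2 * u * (u + 1) /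
       ((u - 1) * (u * q - 1) * (u - q))).
    by field; rewrite ?u1 ?uq ?q0 ?uq2.
  rewrite oppr_eq0 !mulf_eq0 !invr_eq0 !mulf_eq0 (negbTE uN1) (negbTE q10) (negbTE u0).
  by rewrite (negbTE u1) (negbTE uq) (negbTE uq2) /= orbF addr_eq0 => /eqP.
case: uN => uE; [left|right] => //.
by rewrite uE mulN1r.
Qed.

(** Even powers of [q] serve as parameters: multiplying one by [q] gives an odd exponent below
    [m.+2], hence never another even power in the range. *)
Lemma gau_wu_predT_ge (a b c : C) : `|b| != `|c| ->
  has_boundary_orthonormal (toeplitz_up m.+1 xpredT a b c) m.+2./2.
Proof.
move=> bc; apply/has_boundary_orthonormalP => //.
have q_unit : `|q| = 1.
  by apply/eqP; rewrite -(@pexpr_eq1 _ _ m.+2) // -normrX qN normr1.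
exists (fun i : 'I__ => q ^+ i.*2) => [i|i j ij]; first by rewrite normrX q_unit expr1n.
have i2 := ltn_ord i; have j2 := ltn_ord j.
have ij' : i <> j :> nat by move/val_inj => E; rewrite E eqxx in ij.
apply: wave_dot_predT_eq0; rewrite ?normrX ?q_unit ?expr1n //.
- by rewrite exprMn exprVn !(exprAC _ _ m.+2) qN !expr1n invr1 mulr1.
- by apply/eqP => /expr_q_inj; lia.
- by rewrite -exprSr; apply/eqP => /expr_q_inj; lia.
by rewrite -exprSr; apply/eqP => /expr_q_inj; lia.
Qed.

Lemma gau_wu_predT_le (a b c : C) k : `|b| != `|c| ->
  has_boundary_orthonormal (toeplitz_up m.+1 xpredT a b c) k ->
  (k <= m.+2./2)%N.
Proof.
move=> bc /has_boundary_orthonormalP [] // z z1 zz.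
case: k => // k in z z1 zz *.
have zN0 i : z i != 0 by apply: unit_neq0.
have sep i j : i != j -> [/\ z i != z j, z i * q != z j &
    (z i / z j) ^+ m.+2 = 1 \/ z i = - z j].
  by move=> ij; apply: wave_dot_predT_neq0 => //; apply: zz.
have z_inj : injective z.
  by move=> i j zE; apply/eqP; apply/negPn/negP => /sep [/eqP]; rewrite zE.
(* Unequal powers exclude the root-of-unity alternative, leaving only the ratio -1. *)
have powE i j : z i ^+ m.+2 != z j ^+ m.+2 -> z i = - z j.
  move=> ij; have neq_ij : i != j by apply: contraNneq ij => ->.
  have [_ _ []//] := sep i j neq_ij.
  move=> E; case/eqP: ij; rewrite -[RHS]mul1r -E exprMn exprVn divfK //.
  by rewrite expf_neq0.
have [/forallP allE|/forallPn [i zi]] :=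
  boolP [forall i, z i ^+ m.+2 == z ord0 ^+ m.+2].
  (* all of z_i and q z_i are distinct roots of X^N - z_0^N *)
  pose s := codom z ++ codom (fun i => z i * q).
  have s_uniq : uniq s.
    rewrite cat_uniq; apply/and3P; split; first exact/injectiveP.
      apply/hasPn => _ /codomP [i ->]; apply/negP => /codomP [j /eqP].
      have [<-|ij] := eqVneq i j; last by have [_ /negbTE ->] := sep i j ij.
      rewrite -subr_eq0 -[X in _ - X]mulr1 -mulrBr mulf_eq0 subr_eq0.
      by rewrite (negbTE q1) orbF (negbTE (zN0 i)).
    by apply/injectiveP => i j /(mulIf q0) /z_inj.
  have s_roots : all (root ('X^(m.+2) - (z ord0 ^+ m.+2)%:P)) s.
    apply/allP => x; rewrite mem_cat rootE !hornerE subr_eq0.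
    by case/orP => /codomP [i ->]; rewrite ?exprMn ?qN ?mulr1 (eqP (allE i)).
  have s_size : size s = (k.+1 + k.+1)%N.
    by rewrite size_cat !size_codom card_ord.
  have := max_poly_roots _ s_roots s_uniq.
  rewrite -size_poly_eq0 size_XnsubC // s_size => /(_ isT).
  by rewrite ltnS; lia.
(* here some ratio is -1 with distinct N-th powers, which leaves no room for a
   third vector *)
have : {subset codom z <= [:: z ord0; - z ord0]}.
  move=> _ /codomP [j ->]; rewrite !inE.
  have [zj|/powE ->] := eqVneq (z j ^+ m.+2) (z ord0 ^+ m.+2); last by rewrite eqxx orbT.
  have -> : z j = - z i by apply: powE; rewrite zj eq_sym.
  by rewrite (powE i ord0 zi) opprK eqxx.
have z_uniq : uniq (codom z) by apply/injectiveP.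
move/(uniq_leq_size z_uniq); rewrite size_codom card_ord /= => k2.
(* Two vectors respect the bound, since [1 < m] gives [2 <= m.+2./2]. *)
lia.
Qed.

End Hopping.

(** * Sine weights *)

Section Sine.
Variable R : realType.
Implicit Type x t : R.
Local Open Scope complex_scope.

Lemma expr_cos_sin x k :
  (cos x +i* sin x) ^+ k = cos (k%:R * x) +i* sin (k%:R * x) :> R[i].
Proof.
elim: k => [|k IHk]; first by rewrite expr0 mul0r cos0 sin0.
rewrite exprSr IHk -natr1 mulrDl mul1r cosD sinD; simpc.
by congr (_ +i* _); rewrite [cos _ * sin x + _]addrC.
Qed.

(** The weights are [sin (i * t)] with [t = pi / m.+2]. Addition formulas give the recurrence with
    [rho = cos t]; the double angle formula gives the squares, with [q] of argument [2 * t] and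
    [kappa] equal to 1/4. *)
Lemma sine_weights (m : nat) : exists (w : nat -> R[i]) (rho q kappa : R[i]),
  [/\ w 0 = 0, w m.+2 = 0, forall i, (i <= m)%N -> 0 < w i.+1
    & forall i, w i + w i.+2 = 2 * rho * w i.+1] /\
  [/\ q != 0, kappa != 0
    & forall i, w i ^+ 2 = kappa * (2 - q ^+ i - q ^- i)].
Proof.
pose t : R := pi / m.+2%:R.
exists (fun i => (sin (i%:R * t))%:C), (cos t)%:C.
exists (cos (2 * t) +i* sin (2 * t)), (4^-1)%:C.
split; split.
- by rewrite mul0r sin0.
- by rewrite /t mulrC divfK ?pnatr_eq0 // sinpi.
- move=> i im; rewrite ltcR sin_gt0_pi // /t mulrA.
  rewrite mulr_gt0 ?mulr_gt0 ?pi_gt0 ?invr_gt0 ?ltr0n //=.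
  by rewrite mulrAC gtr_pMl ?pi_gt0 // ltr_pdivrMr ?ltr0n // mul1r ltr_nat.
- move=> i; rewrite -[2]/(2%:R) -(rmorph_nat (real_complex R)) -!rmorphM -rmorphD /=.
  congr (_%:C).
  have -> : i%:R * t = i.+1%:R * t - t by rewrite -natr1; ring.
  have -> : i.+2%:R * t = i.+1%:R * t + t by rewrite -[i.+2%:R]natr1; ring.
  by rewrite sinB sinD; ring.
- rewrite eq_complex /=; apply/negP => /andP [/eqP c0 /eqP s0].
  by have /eqP := cos2Dsin2 (2 * t); rewrite c0 s0 expr0n addr0 eq_sym oner_eq0.
- by rewrite eq_complex /= eqxx andbT invr_eq0 pnatr_eq0.
move=> i; rewrite expr_cos_sin.
have -> : i%:R * (2 * t) = (i%:R * t) *+ 2 by ring.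
set x := i%:R * t.
have -> : (cos (x *+ 2) +i* sin (x *+ 2))^-1 = cos (x *+ 2) -i* sin (x *+ 2).
  apply: mulr1_eq; simpc.
  have := cos2Dsin2 (x *+ 2); rewrite !expr2 => ->.
  by rewrite [sin _ * cos _]mulrC addNr.
have -> : (2 : R[i]) = (2%:R : R)%:C by rewrite rmorph_nat.
rewrite cos_mulr2n cos2sin2.
simpc.
rewrite -rmorphXn /=; congr (_ +i* _). by field; rewrite ?pnatr_eq0.
Qed.

End Sine.

Theorem proposition16 (R : realType) (n : nat) (a b c : R[i]) :
  (3 <= n)%N -> `|b| != `|c| ->
  let A := toeplitz3 n a b c in
  let A' := swap_odd A in
  ~ unitarily_reducible A /\
  unitarily_reducible A' /\
  base_poly A = base_poly A' /\
  numerical_range A = numerical_range A' /\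
  gau_wu A = uphalf n /\
  gau_wu A' = 2%N /\
  ((5 <= n)%N -> gau_wu A != gau_wu A').
Proof.
case: n => [|m m_gt1 bc A A']; first by move=> n3; exfalso.
have m_gt0 : (0 < m)%N by apply: ltnW.
have [w [rho [q [kappa [[w0 wN w_gt0 wS] [q0 kappa0 wq]]]]]] := sine_weights R m.
have AE : A = toeplitz_up m.+1 xpredT a b c by apply: toeplitz3_up.
have A'E : A' = toeplitz_up m.+1 odd a b c by apply: swap_odd_up.
have kA : gau_wu A = uphalf m.+1.
  rewrite AE; apply: gau_wuE => [|k].
    by apply: (gau_wu_predT_ge w0 wN w_gt0 wS m_gt0 q0 kappa0 m_gt1 wq).
  by apply: (gau_wu_predT_le w0 wN w_gt0 wS m_gt0 q0 kappa0 m_gt1 wq).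
have kA' : gau_wu A' = 2%N.
  by rewrite A'E; apply: (gau_wu_odd w0 wN w_gt0 wS m_gt0).
split; first exact: toeplitz3_irreducible.
split; first by rewrite A'E; exact: (toeplitz_up_odd_reducible w0 wN w_gt0 wS).
split; first exact/esym/base_poly_swap_odd.
split; first by rewrite AE A'E !(numerical_range_toeplitz_up w0 wN w_gt0 wS m_gt0).
split; first exact: kA.
split; first exact: kA'.
(* Here [n = m.+1], so [5 <= n] reads [6 <= m.+2], and halving gives at least 3. *)
by move=> n5; rewrite kA kA' gtn_eqF //; exact: (@half_leq 6 m.+2).
Qed.
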